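(* There is a function $g:\mathbb{N}\to\mathbb{R}$ with $g(t)=(16+o(1))\log_2 t$ as $t\to\infty$ such that every $K_t$-minor-free graph with girth at least $g(t)$ is $2$-colourable with clustering $2$.
   Context: Graphs are finite, simple and undirected. A graph is $K_t$-minor-free if the complete graph $K_t$ is not a minor of it (i.e. $K_t$ cannot be obtained, up to isomorphism, from a subgraph by contracting edges). The girth of a graph is the length of its shortest cycle (infinite for a forest). A $2$-colouring assigns one of at most two colours to each vertex (not necessarily properly). A monochromatic component is a connected component of the subgraph induced by all vertices of a single colour. A colouring has clustering $c$ if every monochromatic component has at most $c$ vertices. *)

(* Defs.v *)
From HB Require Import structures.
From mathcomp Require Import all_boot all_order all_algebra.
From mathcomp Require Import all_classical all_reals all_analysis.

Set Implicit Arguments.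
Unset Strict Implicit.
Unset Printing Implicit Defensive.

Import Order.TTheory GRing.Theory Num.Theory.
Import numFieldNormedType.Exports.

Record sgraph := SGraph {
  vertex :> finType;
  adj : rel vertex;
  adj_sym : symmetric adj;
  adj_irrefl : irreflexive adj }.

Definition graph_iso (G H : sgraph) : Prop :=
  exists2 f : G -> H, bijective f & forall u v, adj (f u) (f v) = adj u v.

Section Complete.
Variable n : nat.

Definition complete_adj : rel 'I_n := fun u v => u != v.

Lemma complete_sym : symmetric complete_adj.
Proof. by move=> u v; rewrite /complete_adj eq_sym. Qed.

Lemma complete_irrefl : irreflexive complete_adj.
Proof. by move=> u; rewrite /complete_adj eqxx. Qed.

Definition complete : sgraph := SGraph complete_sym complete_irrefl.
End Complete.

(* The subgraph of G with vertex set S whose edges are the edges of G that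
   have both ends in S and belong to F. Every subgraph of G has this form. *)
Section Subgraph.
Variables (G : sgraph) (S : {set G}) (F : {set {set G}}).

Definition subgraph_adj : rel {x : G | x \in S} :=
  fun u v => adj (val u) (val v) && ([set val u; val v]%SET \in F).

Lemma subgraph_sym : symmetric subgraph_adj.
Proof. by move=> u v; rewrite /subgraph_adj adj_sym finset.setUC. Qed.

Lemma subgraph_irrefl : irreflexive subgraph_adj.
Proof. by move=> u; rewrite /subgraph_adj adj_irrefl. Qed.

Definition subgraph : sgraph := SGraph subgraph_sym subgraph_irrefl.
End Subgraph.

Definition induced (G : sgraph) (S : {set G}) : sgraph :=
  subgraph S [set: {set G}]%SET.

(* Contraction of the edge xy: the merged vertex is represented by x, and y is
   removed. Loops and parallel edges are suppressed. *)
Section Contract.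
Variables (G : sgraph) (x y : G).

Definition contract_adj : rel {z : G | z != y} := fun u v =>
  (u != v) && [|| adj (val u) (val v),
                  (val u == x) && adj y (val v)
                | (val v == x) && adj (val u) y].

Lemma contract_sym : symmetric contract_adj.
Proof.
move=> u v; rewrite /contract_adj eq_sym adj_sym.
by rewrite (adj_sym (val u)) (adj_sym y) [(val v == x) && _ || _]orbC.
Qed.

Lemma contract_irrefl : irreflexive contract_adj.
Proof. by move=> u; rewrite /contract_adj eqxx. Qed.

Definition contract : sgraph := SGraph contract_sym contract_irrefl.
End Contract.

Inductive contraction (G : sgraph) : sgraph -> Prop :=
| contraction_refl : contraction G G
| contraction_step (K : sgraph) (x y : K) :
    contraction G K -> adj x y -> contraction G (contract x y).

Definition minor (H G : sgraph) : Prop :=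
  exists (S : {set G}) (F : {set {set G}}) (K : sgraph),
    contraction (subgraph S F) K /\ graph_iso K H.

Definition component (G : sgraph) (v : G) : {set G} :=
  [set w | connect (@adj G) v w]%SET.

Definition has_clustering (G : sgraph) (k c : nat) (f : G -> 'I_k) : Prop :=
  forall (i : 'I_k) (v : induced [set u | f u == i]%SET), #|component v| <= c.

(* The colour type 'I_k need not be exhausted: at most k colours are used. *)
Definition colourable_with_clustering (G : sgraph) (k c : nat) : Prop :=
  exists f : G -> 'I_k, has_clustering c f.

Definition graph_cycle (G : sgraph) (p : seq G) : Prop :=
  (2 < size p) /\ ucycle (@adj G) p.

Local Open Scope classical_set_scope.
Local Open Scope ring_scope.

(* Since [ereal_inf set0 = +oo], forests have infinite girth. *)
Definition girth (R : realType) (G : sgraph) : \bar R :=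
  ereal_inf [set (size p)%:R%:E | p in [set p | graph_cycle (G := G) p]].

Definition log2 (R : realType) (x : R) : R := ln x / ln 2.

(* Main.v *)
(* If every nonempty vertex set induces a vertex of degree at most 1 or an edge
   whose two ends have degree at most 2, one deletes such a vertex or edge,
   colours the rest by induction and gives each deleted vertex the colour
   opposite to its at most one remaining neighbour: every vertex then has at
   most one neighbour of its own colour. Otherwise some induced subgraph has
   minimum degree at least 2 and its vertices of degree 2 are independent, so a
   ball of radius 2m + 1 has at least 2^m vertices of degree at least 3.
   Partition this graph by a breadth-first forest into cells of radius at most
   2r = 2(2m + 1), each containing the ball of radius r around its centre. When
   the girth exceeds 8r + 2, cells are trees and two cells are joined by at most
   one edge, so contracting the cells yields average degree at least 2^m. Such a
   graph has a minor with at most 2k vertices and minimum degree at least k,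
   where k = 2^(m-1), and in it one finds t disjoint connected sets of O(log k)
   vertices, each dominating the later ones, as soon as k is of order t log t.
   This needs 2^m of order t log t, that is girth 16 m + O(1) =
   16 log2 t + O(log log t). *)
Require Import Defs.
From HB Require Import structures.
From mathcomp Require Import all_boot all_order all_algebra.
From mathcomp Require Import all_classical all_reals all_analysis.
From mathcomp Require Import zify ring lra.
(* Repeated imports: they restore names that the analysis libraries shadow. *)
From mathcomp.boot Require Import eqtype seq fintype finset bigop.
Require Import Defs.

Set Implicit Arguments.
Unset Strict Implicit.
Unset Printing Implicit Defensive.

(** * Branch models and minors *)

Section Connectivity.
Variable G : sgraph.
Implicit Types (A B : {set G}) (u v w : G).

Definition adj_in A : rel G := fun u v => [&& u \in A, v \in A & adj u v].

(** The empty set counts as connected, so [branch_model] asks for nonempty sets separately. *)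
Definition connected_set A : Prop :=
  forall u v, u \in A -> v \in A -> connect (adj_in A) u v.

Lemma adj_in_connect_sym A : connect_sym (adj_in A).
Proof.
by apply: sym_connect_sym => u v; rewrite /adj_in adj_sym andbCA.
Qed.

Lemma connect_adj_inS A B u v :
  A \subset B -> connect (adj_in A) u v -> connect (adj_in B) u v.
Proof.
move=> sAB; apply: connect_sub => a b /and3P[aA bA ab]; apply: connect1.
by rewrite /adj_in ab !(subsetP sAB).
Qed.

Lemma connected_set_root A w :
  (forall u, u \in A -> connect (adj_in A) u w) -> connected_set A.
Proof.
move=> rt u v uA vA; apply: connect_trans (rt u uA) _.
by rewrite adj_in_connect_sym rt.
Qed.

Lemma connected_set1 u : connected_set [set u].
Proof. by move=> a b /set1P-> /set1P->; apply: connect0. Qed.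

Lemma connected_setU1 A u w :
  connected_set A -> w \in A -> adj u w -> connected_set (u |: A).
Proof.
move=> cA wA uw; apply: (@connected_set_root _ w) => v /setU1P[-> | vA].
  by apply: connect1; rewrite /adj_in uw !inE wA eqxx orbT.
by apply: connect_adj_inS (subsetUr _ _) (cA _ _ vA wA).
Qed.

End Connectivity.

Lemma connect_map (T T' : finType) (e : rel T) (e' : rel T') (f : T -> T') :
  (forall a b, e a b -> connect e' (f a) (f b)) ->
  forall a b, connect e a b -> connect e' (f a) (f b).
Proof.
move=> ee a b /connectP[p + ->]; elim: p a => [|c p IH] a /=.
  by move=> _; apply: connect0.
by case/andP=> /ee ac /IH; apply: connect_trans.
Qed.

(** Branch sets compose without tracking successive contractions, so minors are built in this form
    and converted to [minor] once, at the end. *)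
Definition branch_model (H G : sgraph) (phi : H -> {set G}) : Prop :=
  [/\ forall h, phi h != set0,
      forall h, connected_set (phi h),
      forall h h', h != h' -> [disjoint phi h & phi h']
    & forall h h', adj h h' ->
        exists u v, [/\ u \in phi h, v \in phi h' & adj u v]].

Definition has_model (H G : sgraph) : Prop :=
  exists phi : H -> {set G}, branch_model phi.

Lemma has_model_embed (H G : sgraph) (f : H -> G) :
  injective f -> (forall u v, adj u v -> adj (f u) (f v)) -> has_model H G.
Proof.
move=> injf homf; exists (fun h => [set f h]); split.
- by move=> h; apply/set0Pn; exists (f h); rewrite inE.
- by move=> h; apply: connected_set1.
- by move=> h h' neq; rewrite disjoints1 inE inj_eq.
- by move=> h h' /homf hh; exists (f h), (f h'); rewrite !inE !eqxx.
Qed.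

Lemma connected_bigcup (H G : sgraph) (phi : H -> {set G}) (A : {set H}) :
  branch_model phi -> connected_set A -> connected_set (\bigcup_(h in A) phi h).
Proof.
move=> [_ cphi _ aphi] cA u v /bigcupP[h hA uh] /bigcupP[h' hA' vh'].
have /connectP[p pp def_h'] := cA h h' hA hA'; rewrite {}def_h' in vh' hA'.
have sub k : k \in A -> phi k \subset \bigcup_(h in A) phi h.
  by move=> kA; apply: bigcup_sup.
elim: p h hA u uh pp vh' {hA'} => [|k p IH] h hA u uh /=.
  by move=> _ vh; apply: connect_adj_inS (sub h hA) (cphi h u v uh vh).
case/andP=> /and3P[_ kA /aphi[a [b [ah bk ab]]]] pp vk.
apply: connect_trans (connect_adj_inS (sub h hA) (cphi h u a uh ah)) _.
apply: connect_trans (IH k kA b bk pp vk); apply: connect1.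
by rewrite /adj_in ab (subsetP (sub h hA)) ?(subsetP (sub k kA)).
Qed.

Lemma has_model_trans H K G : has_model K H -> has_model H G -> has_model K G.
Proof.
move=> [psi [npsi cpsi dpsi apsi]] [phi mphi].
have [nphi cphi dphi aphi] := mphi.
exists (fun k => \bigcup_(h in psi k) phi h); split.
- move=> k; have /set0Pn[h hk] := npsi k; have /set0Pn[u uh] := nphi h.
  by apply/set0Pn; exists u; apply/bigcupP; exists h.
- by move=> k; apply: connected_bigcup.
- move=> k k' /dpsi dkk'; rewrite -setI_eq0; apply/eqP/setP => u.
  rewrite !inE; apply/negP => /andP[/bigcupP[h hk uh] /bigcupP[h' hk' uh']].
  have [eqh | /dphi dhh'] := eqVneq h h'.
    by rewrite -eqh (disjointFr dkk' hk) in hk'.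
  by rewrite (disjointFr dhh' uh) in uh'.
- move=> k k' /apsi[h [h' [hk hk' /aphi[u [v [uh vh' uv]]]]]].
  by exists u, v; split=> //; apply/bigcupP; [exists h | exists h'].
Qed.

(** The fibres of [f] are the branch sets. While [f] is not injective, connectedness gives an edge
    inside a fibre; contracting it preserves the hypotheses and lowers [#|K|]. An injective [f] is
    an isomorphism. *)
Lemma contraction_fibers t (G K : sgraph) (f : K -> 'I_t) :
  contraction G K ->
  (forall i, exists x, f x = i) ->
  (forall x y, f x = f y -> connect [rel a b | adj a b && (f a == f b)] x y) ->
  (forall i j, i != j -> exists x y, [/\ f x = i, f y = j & adj x y]) ->
  exists2 K' : sgraph, contraction G K' & graph_iso K' (complete t).
Proof.
have [n] := ubnP #|K|.
elim: n K f => // n IH K f ltKn cGK surjf connf adjf.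
have [/injectiveP injf | ninjf] := boolP (injectiveb f).
  exists K => //; exists f.
    by apply: (inj_card_bij injf); rewrite -(card_codom injf) subset_leq_card //;
       apply/subsetP=> i _; have [x <-] := surjf i; apply: codom_f.
  move=> u v /=; rewrite /complete_adj (inj_eq injf).
  apply/idP/idP => [neq | ]; last by apply: contraTN => /eqP->; rewrite adj_irrefl.
  have /adjf[x [y [fx fy xy]]] : f u != f v by rewrite (inj_eq injf).
  by rewrite -(injf _ _ fx) -(injf _ _ fy).
have {ninjf} [x [y [xy fxy]]] : exists x y : K, adj x y /\ f x = f y.
  case/injectivePn: ninjf => x [y neq /connf /connectP[[|z p] /=]].
    by move=> _ eq; rewrite eq eqxx in neq.
  by case/andP=> /andP[xz /eqP eq] _ _; exists x, z.
have nxy : x != y by apply: contraTneq xy => ->; rewrite adj_irrefl.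
pose X : contract x y := exist _ x nxy.
(* [insubd] returns its default [X], that is [x], exactly at [y]: [pr] is the contraction map. *)
pose pr (a : K) : contract x y := insubd X a.
have prE a : val (pr a) = if a == y then x else a.
  by rewrite /pr val_insubd /=; case: eqP.
have fpr a : f (val (pr a)) = f a by rewrite prE; case: eqP => // ->.
have prV u : pr (val u) = u by apply: valKd.
have adjpr a b : adj a b -> pr a != pr b -> @adj (contract x y) (pr a) (pr b).
  move=> ab neq /=; rewrite /contract_adj neq /= !prE.
  have [eay | nay] := eqVneq a y; have [eby | nby] := eqVneq b y.
  - by rewrite eay eby adj_irrefl in ab.
  - by rewrite eay in ab; rewrite eqxx ab /= orbT.
  - by rewrite eby in ab; rewrite eqxx ab /= !orbT.
  - by rewrite ab.
apply: (IH (contract x y) (f \o val)).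
- have cardc : #|contract x y| = #|K|.-1 by rewrite card_sig -(cardC1 y); apply: eq_card.
  by rewrite cardc; have : 0 < #|K| by [apply/card_gt0P; exists x]; lia.
- exact: contraction_step.
- by move=> i; have [a <-] := surjf i; exists (pr a); rewrite /= fpr.
- move=> u v /= /connf uv; rewrite -(prV u) -(prV v).
  apply: connect_map uv => a b /= /andP[ab fab].
  have [-> | neq] := eqVneq (pr a) (pr b); first exact: connect0.
  by apply: connect1; rewrite /= !fpr fab andbT; apply: adjpr.
- move=> i j neq; have [a [b [fa fb ab]]] := adjf i j neq.
  exists (pr a), (pr b); rewrite /= !fpr; split=> //; apply: adjpr => //.
  by apply: contraNneq neq => eq; rewrite -fa -fb -(fpr a) -(fpr b) eq.
Qed.

(** On the union of the branch sets, the labelling of vertices by their branch sets satisfies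
    [contraction_fibers]. *)
Lemma has_model_minor t (G : sgraph) :
  has_model (complete t) G -> minor (complete t) G.
Proof.
move=> [phi [nphi cphi dphi aphi]].
pose S := \bigcup_i phi i; exists S, setT.
have /fin_all_exists[f fP] : forall x : subgraph S setT, exists i, val x \in phi i.
  by move=> x; have /bigcupP[i _ xi] := valP x; exists i.
have phiS i u : u \in phi i -> u \in S by move=> ui; apply/bigcupP; exists i.
have fE i (x : subgraph S setT) : val x \in phi i -> f x = i.
  move=> xi; apply/eqP; apply/negPn/negP => /dphi d.
  by have := fP x; rewrite (disjointFl d xi).
have [] := @contraction_fibers t (subgraph S setT) _ f (contraction_refl _).
- move=> i; have /set0Pn[u ui] := nphi i.
  by exists (exist _ u (phiS i u ui)); apply: fE.
- move=> x y fxy; have yi := fP y; rewrite -fxy in yi.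
  have := cphi _ _ _ (fP x) yi; set i := f x.
  pose pr u : subgraph S setT := insubd x u.
  have prE u : u \in phi i -> val (pr u) = u.
    by move=> /phiS uS; rewrite /pr insubdK.
  move=> xy; suff : connect [rel a b | adj a b && (f a == f b)] (pr (val x)) (pr (val y)).
    by rewrite /pr !valKd.
  apply: connect_map xy => a b /and3P[ai bi ab]; apply: connect1 => /=.
  rewrite /subgraph_adj !prE // ab in_setT /= (fE i) ?prE // eq_sym.
  by rewrite (fE i) ?prE.
- move=> i j neq; have [u [v [ui vj uv]]] := aphi i j neq.
  exists (exist _ u (phiS i u ui)), (exist _ v (phiS j v vj)).
  by split; [exact: fE | exact: fE | rewrite /= /subgraph_adj uv in_setT].
by move=> K' cK iK; exists K'.
Qed.

Ltac card_nia :=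
  repeat match goal with |- context [@card ?T ?A] => generalize (@card T A) end;
  clear; intros; nia.

(** * Clique models in dense graphs *)

Section Domination.
Variable G : sgraph.
Implicit Types (A C D W : {set G}) (u v w : G).

Definition nbrs_in W u : {set G} := [set v in W | adj u v].

Definition cnbhd W C : {set G} :=
  [set v in W | [exists u in C, (u == v) || adj u v]].

Lemma cnbhdP W C v :
  reflect (v \in W /\ exists2 u, u \in C & u = v \/ adj u v) (v \in cnbhd W C).
Proof.
rewrite inE; apply: (iffP andP) => -[vW ex]; split=> //.
  have /exists_inP[u uC /orP[/eqP|]] := ex; first by exists u; [|left].
  by exists u; [|right].
have [u uC uv] := ex; apply/exists_inP; exists u => //; apply/orP.
by case: uv => [->|]; [left | right].
Qed.

Lemma cnbhd_sub W C : cnbhd W C \subset W.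
Proof. by apply/subsetP=> v /cnbhdP[]. Qed.

Lemma cnbhd_ext W C : C \subset W -> C \subset cnbhd W C.
Proof.
move=> /subsetP sCW; apply/subsetP=> v vC; apply/cnbhdP.
by split; [exact: sCW | exists v; [|left]].
Qed.

Lemma cnbhdS W C D : C \subset D -> cnbhd W C \subset cnbhd W D.
Proof.
move=> /subsetP sCD; apply/subsetP=> v /cnbhdP[vW [u uC uv]].
by apply/cnbhdP; split=> //; exists u => //; apply: sCD.
Qed.

Lemma connected_setU1_cnbhd W C v :
  connected_set C -> v \in cnbhd W C -> connected_set (v |: C).
Proof.
move=> cC /cnbhdP[_ [u uC [<-|uv]]]; last first.
  by apply: connected_setU1 uC _; rewrite // adj_sym.
by rewrite (setUidPr _) // sub1set.
Qed.

Lemma connect_exit (T : finType) (e : rel T) (A : {set T}) x y :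
  connect e x y -> x \in A -> y \notin A ->
  exists a b, [/\ a \in A, b \notin A & e a b].
Proof.
case/connectP=> p + ->; elim: p x => [|z p IH] x /= => [_ -> //|].
case/andP=> xz pp xA yA; have [zA | zA] := boolP (z \in A); first exact: IH pp zA yA.
by exists x, z.
Qed.

Lemma connected_component A w :
  w \in A -> connected_set [set v in A | connect (adj_in A) w v].
Proof.
move=> wA; set B := [set _ in _ | _]; apply: (@connected_set_root _ _ w) => v.
rewrite adj_in_connect_sym inE => /andP[_ /connectP[p + ->]].
have : w \in B by rewrite inE wA connect0.
suff gen a q : a \in B -> path (adj_in A) a q -> connect (adj_in B) a (last a q).
  exact: gen.
elim: q a => [|b q IH] a aB /=; first by rewrite connect0.
case/andP=> ab qq; have bB : b \in B.
  move: aB ab; rewrite !inE => /andP[_ wa] ab; have /and3P[_ -> _] := ab.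
  exact: connect_trans wa (connect1 ab).
apply: connect_trans (IH b bB qq); apply: connect1.
by case/and3P: ab => _ _ ab; apply/and3P.
Qed.

Variables (W : {set G}) (d : nat).
Hypotheses (connW : connected_set W) (d_gt0 : 0 < d) (leWd : #|W| <= 4 * d).
Hypothesis degW : forall u, u \in W -> d <= #|nbrs_in W u|.

(* While some vertex is at distance more than 2 from C, some b is at distance
   exactly 3; adding a path to b costs 3 vertices, and the neighbourhood of b is
   disjoint from that of C, so #|C| * d <= 3 * #|cnbhd W C| is maintained. *)
Lemma connected_two_dominating w0 : w0 \in W ->
  exists C, [/\ C \subset W, C != set0, connected_set C, #|C| <= 12
              & W \subset cnbhd W (cnbhd W C)].
Proof.
move=> w0W.
suff [C [sCW nC cC leC domC]] : exists C, [/\ C \subset W, C != set0, connected_set C,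
    #|C| * d <= 3 * #|cnbhd W C| & W \subset cnbhd W (cnbhd W C)].
  (* The 12 comes from [#|C| * d <= 3 * #|W| <= 12 * d]. *)
  exists C; split=> //; have := subset_leq_card (cnbhd_sub W C).
  by move: leC leWd d_gt0; card_nia.
have : exists C, [/\ C \subset W, C != set0, connected_set C & #|C| * d <= 3 * #|cnbhd W C|].
  exists [set w0]; split.
  - by rewrite sub1set.
  - by apply/set0Pn; exists w0; rewrite inE.
  - exact: connected_set1.
  rewrite cards1 mul1n; apply: leq_trans (degW w0W) _.
  apply: leq_trans (leq_pmull _ _) => //; apply: subset_leq_card.
  apply/subsetP=> v; rewrite inE => /andP[vW wv]; apply/cnbhdP.
  by split=> //; exists w0; [rewrite inE | right].
case=> C; have [n] := ubnP (#|W| - #|C|).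
elim: n C => // n IH C leCn [sCW nC cC leC].
have [domC | /subsetPn[z zW zC]] := boolP (W \subset cnbhd W (cnbhd W C)).
  by exists C.
have /set0Pn[c cC0] := nC; have sCC := cnbhd_ext sCW.
have sNN := cnbhd_ext (cnbhd_sub W C).
have cNN := subsetP sNN _ (subsetP sCC _ cC0).
have [a [b [aN bN /and3P[aW bW ab]]]] :=
  connect_exit (connW (subsetP sCW _ cC0) zW) cNN zC.
have aNC : a \notin cnbhd W C.
  by apply: contraNN bN => aC; apply/cnbhdP; split=> //; exists a => //; right.
have /cnbhdP[_ [a' a'N [eq|a'a]]] := aN; first by rewrite -eq a'N in aNC.
have a'W := subsetP (cnbhd_sub W C) _ a'N.
(* Inside [W], the vertices [a'], [a], [b] are at distances 1, 2, 3 from [C] and form a path. *)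
pose C' := b |: (a |: (a' |: C)).
have sCC' : C \subset C' by rewrite /C'; do 3!apply: subset_trans (subsetUr _ _).
have bC : b \notin C by apply: contraNN bN => /(subsetP sCC)/(subsetP sNN).
have ltCC' : #|C| < #|C'|.
  by apply: proper_card; apply/properP; split=> //; exists b; rewrite // !inE eqxx.
have sC'W : C' \subset W.
  by apply/subsetP=> v; rewrite !inE => /or4P[/eqP->|/eqP->|/eqP->|/(subsetP sCW)].
apply: (IH C').
  by move: leCn ltCC' (subset_leq_card sC'W); card_nia.
split=> //.
- by apply/set0Pn; exists b; rewrite !inE eqxx.
- have c1 := connected_setU1_cnbhd cC a'N.
  have c2 : connected_set (a |: (a' |: C)).
    by apply: (connected_setU1 (w := a') c1); rewrite ?inE ?eqxx // adj_sym.
  by apply: (connected_setU1 (w := a) c2); rewrite ?inE ?eqxx // adj_sym.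
have leC' : #|C'| <= 3 + #|C|.
  by rewrite /C' !cardsU1; do 3!case: (_ \notin _) => /=; card_nia.
have : #|cnbhd W C| + d <= #|cnbhd W C'|; last by move: leC leC'; card_nia.
apply: leq_trans (_ : #|cnbhd W C :|: nbrs_in W b| <= _).
  rewrite cardsU (_ : _ :&: _ = set0) ?cards0 ?subn0 ?leq_add2l ?degW //.
  apply/setP=> v; rewrite in_setI in_set0; apply: contraNF bN => /andP[vC].
  rewrite inE => /andP[_ bv]; apply/cnbhdP; split=> //.
  by exists v => //; right; rewrite adj_sym.
apply/subset_leq_card; rewrite subUset cnbhdS //=; apply/subsetP=> v.
rewrite inE => /andP[vW bv]; apply/cnbhdP; split=> //.
by exists b; [rewrite !inE eqxx | right].
Qed.

(** Double counting: at least [d * #|U|] adjacent pairs join [W] to [U], and [#|W| <= 4 * d], so an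
    average vertex of [W] sees a quarter of [U]. *)
Lemma good_dominator (U : {set G}) : U \subset W -> W != set0 ->
  exists2 w, w \in W & #|U| <= 4 * #|nbrs_in U w|.
Proof.
move=> sUW nW; have [/existsP[w /andP[wW le]] | /existsPn no] :=
  boolP [exists w, (w \in W) && (#|U| <= 4 * #|nbrs_in U w|)]; first by exists w.
have : \sum_(w in W) #|nbrs_in U w| = \sum_(u in U) #|nbrs_in W u|.
  rewrite (eq_bigr (fun w => \sum_(u in U | adj w u) 1)); last first.
    by move=> w _; rewrite sum1_card; apply: eq_card => u; rewrite !inE.
  rewrite (exchange_big_dep (mem U)) /=; last by move=> w u _ /andP[].
  apply: eq_bigr => u uU; rewrite sum1_card; apply: eq_card => w.
  by rewrite !inE uU adj_sym.
move=> eqs.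
have : \sum_(w in W) 4 * #|nbrs_in U w| < \sum_(w in W) #|U|.
  have /set0Pn[w0 w0W] := nW; rewrite (bigD1 w0) // [X in _ < X](bigD1 w0) //=.
  rewrite -addSn leq_add //; first by have := no w0; rewrite w0W /= -ltnNge.
  by apply: leq_sum => w /andP[wW _]; have := no w; rewrite wW /= -ltnNge => /ltnW.
rewrite -big_distrr /= eqs sum_nat_const.
have : \sum_(u in U) d <= \sum_(u in U) #|nbrs_in W u|.
  by apply: leq_sum => u uU; apply: degW; apply: (subsetP sUW).
rewrite sum_nat_const; move: leWd d_gt0; set s := \sum_(_ in _) _; move: s; card_nia.
Qed.

(** Starting from the two-dominating set, each round adds a vertex [w] adjacent to a quarter of the
    undominated vertices and one vertex [y] that attaches it. Two vertices thus shrink the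
    undominated part by the factor 3/4, and after [i] rounds fewer than one is left. *)
Lemma connected_dominating w0 i : w0 \in W -> #|W| * 3 ^ i < 4 ^ i ->
  exists D, [/\ D \subset W, D != set0, connected_set D, #|D| <= 12 + 2 * i
              & W \subset cnbhd W D].
Proof.
move=> w0W lti; have [C [sCW nC cC leC /subsetP domC]] := connected_two_dominating w0W.
have nW : W != set0 by apply/set0Pn; exists w0.
suff [D [sCD sDW cD leD leU]] : exists D, [/\ C \subset D, D \subset W, connected_set D,
    #|D| <= 12 + 2 * i & #|W :\: cnbhd W D| * 4 ^ i <= #|W| * 3 ^ i].
  exists D; split=> //; first by apply: contraNneq nC => D0; rewrite -subset0 -D0.
  rewrite -setD_eq0 -cards_eq0 -leqn0 -ltnS -(ltn_pmul2r (expn_gt0 4 i)) mul1n.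
  by move: leU lti; card_nia.
elim: i {lti} => [|i [D [sCD sDW cD leD leU]]].
  by exists C; split=> //; rewrite !muln1 subset_leq_card // subsetDl.
set U := W :\: _ in leU.
have [w wW lew] := good_dominator (subsetDl W _ : U \subset W) nW.
have [y [yW yN wy]] : exists y, [/\ y \in W, y \in cnbhd W D & w \in cnbhd W (y |: D)].
  have /cnbhdP[_ [y yC wy]] := domC w wW.
  have yN := subsetP (cnbhdS W sCD) _ yC.
  exists y; split=> //; first by apply: (subsetP (cnbhd_sub W C)).
  by apply/cnbhdP; split=> //; exists y => //; rewrite !inE eqxx.
exists (w |: (y |: D)); split.
- by do 2!apply: subset_trans (subsetUr _ _).
- by apply/subsetP=> v; rewrite !inE => /or3P[/eqP->|/eqP->|/(subsetP sDW)].
- exact: connected_setU1_cnbhd (connected_setU1_cnbhd cD yN) wy.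
- by move: leD; rewrite !cardsU1; do 2!case: (_ \notin _) => /=; card_nia.
set D' := w |: _.
have : 4 * #|W :\: cnbhd W D'| <= 3 * #|U|.
  have : #|W :\: cnbhd W D'| <= #|U :\: nbrs_in U w|.
    apply/subset_leq_card/subsetP=> v; rewrite in_setD => /andP[vD' vW].
    rewrite in_setD andbC /U in_setD vW andbT; apply/andP; split.
      apply: contra vD'; apply: (subsetP (cnbhdS W _)).
      by do 2!apply: subset_trans (subsetUr _ _).
    rewrite inE; apply: contra vD' => /andP[_ wv]; apply/cnbhdP; split=> //.
    by exists w; [rewrite !inE eqxx | right].
  rewrite [#|U :\: _|]cardsD (setIidPr _); first by move: lew; card_nia.
  by apply/subsetP=> v; rewrite inE => /andP[].
rewrite !expnS => le; move: leU (leq_mul le (leqnn (4 ^ i))).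
by move: (4 ^ i) (3 ^ i); card_nia.
Qed.

End Domination.

(** Indexing by [nat] lets a model of size [j] grow by redefining the family at [j]. *)
Definition clique_model (G : sgraph) (W : {set G}) j (D : nat -> {set G}) : Prop :=
  (forall i, i < j -> [/\ D i \subset W, D i != set0 & connected_set (D i)]) /\
  (forall i i', i < i' < j -> [disjoint D i & D i'] /\
     exists u v, [/\ u \in D i, v \in D i' & adj u v]).

(* Split off a connected dominating set of W, pass to a component of what is
   left, and repeat: the degrees drop by at most s at each step. *)
Lemma dense_clique_model (G : sgraph) d s i j (W : {set G}) :
  0 < d -> #|G| <= 4 * d -> #|G| * 3 ^ i < 4 ^ i -> 12 + 2 * i <= s ->
  W != set0 -> connected_set W ->
  (forall u, u \in W -> d + j * s <= #|nbrs_in W u|) ->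
  exists D, clique_model W j D.
Proof.
move=> d_gt0 leGd lti les; elim: j W => [|j IH] W nW cW degW.
  by exists (fun=> set0); split=> // ? ?; rewrite ltn0 andbF.
have leWG : #|W| <= #|G| by apply: max_card.
have /set0Pn[w0 w0W] := nW.
have [|||D [sDW nD cD leD domD]] := @connected_dominating _ W d cW d_gt0 _ _ w0 i w0W.
- exact: leq_trans leGd.
- by move=> u uW; apply: leq_trans (degW u uW); card_nia.
- by apply: leq_ltn_trans lti; rewrite leq_mul2r leWG orbT.
have leDs : #|D| <= s by apply: leq_trans les.
(* Otherwise all neighbours of [w0] in [W] would lie in [D], which has at most [s] vertices, fewer
   than the degree bound. *)
have [w1 w1W w1D] : exists2 w1, w1 \in W & w1 \notin D.
  apply/subsetPn; apply/negP=> sWD.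
  have := degW w0 w0W; have : #|nbrs_in W w0| <= #|D|.
    by apply/subset_leq_card/subsetP=> v; rewrite inE => /andP[/(subsetP sWD)].
  by move: d_gt0 leDs; card_nia.
have w1WD : w1 \in W :\: D by rewrite in_setD w1D.
pose W' := [set v in W :\: D | connect (adj_in (W :\: D)) w1 v].
have sW' : W' \subset W :\: D by apply/subsetP=> v; rewrite inE => /andP[].
have w1W' : w1 \in W' by rewrite inE w1WD connect0.
have [||F [F1 F2]] := IH W' _ (connected_component w1WD).
- by apply/set0Pn; exists w1.
- move=> u uW'; have uWD := subsetP sW' u uW'; have /setDP[uW uD] := uWD.
  have := degW u uW.
  (* A neighbour of [u] in [W] lies in [D] or in the component of [u]. *)
  have : #|nbrs_in W u| <= #|nbrs_in W' u| + #|D|; last by move: leDs; card_nia.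
  apply: leq_trans (_ : #|nbrs_in W' u :|: D| <= _); last by rewrite leq_card_setU.
  apply/subset_leq_card/subsetP=> v; rewrite inE => /andP[vW uv].
  rewrite in_setU; case: (boolP (v \in D)) => vD; first by rewrite orbT.
  have vWD : v \in W :\: D by rewrite in_setD vD.
  rewrite orbF inE uv andbT inE vWD; move: uW'; rewrite inE => /andP[_ /connect_trans]; apply.
  by apply: connect1; rewrite /adj_in uWD vWD.
exists (fun i => if i == j then D else F i); split=> [k|k k' /andP[ltk ltk']].
  rewrite ltnS leq_eqVlt; have [_ _|_ /= /F1[sF nF cF]] := eqVneq k j; split=> //.
  by apply: subset_trans sF (subset_trans sW' (subsetDl _ _)).
have ltkj : k < j by apply: leq_trans ltk _; rewrite -ltnS.
rewrite (ltn_eqF ltkj); move: ltk'; rewrite ltnS leq_eqVlt.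
have [_ _ | _ /= ltk'] := eqVneq k' j; last by apply: F2; rewrite ltk.
have [sF /set0Pn[u uF] _] := F1 k ltkj.
have sFWD := subset_trans sF sW'.
have /setDP[uW uD] := subsetP sFWD u uF.
split.
  rewrite disjoint_sym disjoints_subset; apply/subsetP=> v vD; rewrite inE.
  by apply: contraL vD => /(subsetP sFWD)/setDP[].
have /cnbhdP[_ [v vD [eq|uv]]] := subsetP domD u uW; first by rewrite -eq vD in uD.
by exists u, v; split=> //; rewrite adj_sym.
Qed.

Lemma clique_model_has_model (G : sgraph) W t (D : nat -> {set G}) :
  clique_model W t D -> has_model (complete t) G.
Proof.
move=> [D1 D2]; exists (fun i : complete t => D i); split.
- by move=> h; have [] := D1 h (ltn_ord h).
- by move=> h; have [] := D1 h (ltn_ord h).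
- move=> h h' neq; have [lt|lt|/val_inj eq] := ltngtP h h'.
  + by have [] := D2 h h'; rewrite ?lt ?ltn_ord.
  + by rewrite disjoint_sym; have [] := D2 h' h; rewrite ?lt ?ltn_ord.
  + by rewrite eq eqxx in neq.
- move=> h h' neq; have [lt|lt|/val_inj eq] := ltngtP h h'.
  + by have [] := D2 h h'; rewrite ?lt ?ltn_ord.
  + have [|_ [u [v [? ? ?]]]] := D2 h' h; first by rewrite lt ltn_ord.
    by exists v, u; rewrite adj_sym.
  + by move: neq; rewrite /= /complete_adj eq eqxx.
Qed.

(** * Dense minors *)

Definition nbrs (G : sgraph) (u : G) : {set G} := [set v | adj u v].

(** Each edge counts twice, so [#|arcs G|] is the degree sum. *)
Definition arcs (G : sgraph) : {set G * G} := [set a | adj a.1 a.2].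

Lemma card_arcs (G : sgraph) : #|arcs G| = \sum_(u : G) #|nbrs u|.
Proof.
rewrite -sum1_card (eq_bigl (fun a : G * G => true && adj a.1 a.2)); last first.
  by move=> a; rewrite inE.
rewrite -(pair_big_dep xpredT (fun u v : G => adj u v) (fun _ _ => 1)) /=.
by apply: eq_bigr => u _; rewrite sum1_card; apply: eq_card => v; rewrite inE.
Qed.

Lemma leq_card_in_imset (T T' : finType) (A : {set T}) (B : {set T'}) (f : T -> T') :
  {in A &, injective f} -> {in A, forall x, f x \in B} -> #|A| <= #|B|.
Proof.
move=> injf AB; rewrite -(card_in_imset injf); apply: subset_leq_card.
by apply/subsetP=> _ /imsetP[x xA ->]; apply: AB.
Qed.

Lemma has_model_subgraph (G : sgraph) (S : {set G}) F : has_model (subgraph S F) G.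
Proof.
apply: (@has_model_embed (subgraph S F) G val); first exact: val_inj.
by move=> u v /andP[].
Qed.

Lemma has_model_contract (G : sgraph) (x y : G) :
  adj x y -> has_model (contract x y) G.
Proof.
move=> xy; pose phi (z : contract x y) := if val z == x then [set x; y] else [set val z].
have vphi z : val z \in phi z by rewrite /phi; case: ifP => [/eqP->|_]; rewrite !inE eqxx.
have phiP z u : u \in phi z -> u = val z \/ val z = x /\ u = y.
  rewrite /phi; case: ifP => [/eqP->|_]; rewrite !inE; last by move/eqP->; left.
  by case/orP=> /eqP->; [left | right].
exists phi; split.
- by move=> z; apply/set0Pn; exists (val z).
- move=> z; rewrite /phi; case: ifP => _; last exact: connected_set1.
  by apply: (connected_setU1 (@connected_set1 _ y) _ xy); rewrite inE.
- move=> z z' neq; rewrite -setI_eq0; apply/eqP/setP=> u; rewrite !inE.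
  apply/negP=> /andP[/phiP uz /phiP uz'].
  have nzy := valP z; have nzy' := valP z'; rewrite /= in nzy nzy'.
  have : val z = val z' -> False by move/val_inj=> eq; rewrite eq eqxx in neq.
  case: uz uz' => [->|[-> ->]] [|[zx]] //; last by rewrite zx.
    by move=> eq; rewrite eq eqxx in nzy.
  by move=> eq; rewrite -eq eqxx in nzy'.
- move=> z z' /andP[neq /or3P[zz'|/andP[/eqP zx yz']|/andP[/eqP zx yz']]].
  + by exists (val z), (val z').
  + by exists y, (val z'); rewrite vphi /phi zx eqxx !inE eqxx orbT.
  + by exists (val z), y; rewrite vphi /phi zx eqxx !inE eqxx orbT.
Qed.

(** Only arcs between [y] and [x] or a common neighbour are lost; on the others the contraction map
    is injective. *)
Lemma card_arcs_contract (G : sgraph) (x y : G) : adj x y ->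
  #|arcs G| <= #|arcs (contract x y)| + 2 * #|nbrs x :&: nbrs y|.+1.
Proof.
move=> xy; have nxy : x != y by apply: contraTneq xy => ->; rewrite adj_irrefl.
set T := nbrs x :&: nbrs y.
pose bad : {set G * G} := setX (x |: T) [set y] :|: setX [set y] (x |: T).
have card_bad : #|bad| <= 2 * #|T|.+1.
  apply: leq_trans (leq_card_setU _ _) _; rewrite !cardsX !cards1 muln1 mul1n addnn mul2n.
  by rewrite leq_double cardsU1; case: (_ \notin _).
have : #|arcs G| <= #|arcs G :\: bad| + #|bad|.
  by rewrite -(cardsID bad (arcs G)) addnC leq_add2l subset_leq_card // subsetIr.
move=> le1; apply: (leq_trans le1); apply: leq_add card_bad.
pose X : contract x y := exist _ x nxy.
pose pr (a : G) : contract x y := insubd X a.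
have prE a : val (pr a) = if a == y then x else a by rewrite /pr val_insubd /=; case: eqP.
have neq_adj (u v : G) : adj u v -> u != v by apply: contraTneq => ->; rewrite adj_irrefl.
have arcP a : a \in arcs G :\: bad -> [/\ adj a.1 a.2,
    a.1 = y -> adj x a.2 = false /\ a.2 <> x & a.2 = y -> adj x a.1 = false /\ a.1 <> x].
  case: a => u v; rewrite !inE /= => /andP[nbad uv]; split=> // eq; move: nbad uv.
    rewrite eq eqxx /= negb_or => /andP[_]; rewrite negb_or => /andP[/eqP nvx + yv].
    by rewrite yv andbT => /negbTE.
  rewrite eq eqxx andbT negb_or => /andP[+ _]; rewrite negb_or => /andP[/eqP nux + uy].
  by rewrite (adj_sym y) uy andbT => /negbTE.
apply: (@leq_card_in_imset _ _ _ _ (fun a => (pr a.1, pr a.2))).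
- move=> [u v] [u' v'] /arcP[/= uv nu nv] /arcP[/= uv' nu' nv'].
  case=> /(congr1 val) + /(congr1 val).
  rewrite !prE; have /eqP := neq_adj _ _ uv; have /eqP := neq_adj _ _ uv'.
  move: uv uv'; rewrite !(adj_sym x) in nv nv' => uv uv'.
  (* Distinct arcs with one image would join [x] and [y] to the same vertex, a common neighbour, but
     such arcs at [y] are in [bad]. *)
  case: (u =P y) => eu; case: (v =P y) => ev; case: (u' =P y) => eu';
  case: (v' =P y) => ev' ? ? ? ?;
  rewrite /is_true in uv uv';
  try (have [? ?] := nu eu); try (have [? ?] := nv ev);
  try (have [? ?] := nu' eu'); try (have [? ?] := nv' ev'); congruence.
- move=> [u v] /arcP[/= uv nu nv]; rewrite inE /= /contract_adj !prE -(inj_eq val_inj) !prE.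
  have [eu|neu] := eqVneq u y; have [ev|nev] := eqVneq v y.
  + by rewrite eu ev adj_irrefl in uv.
  + rewrite eu in uv nu; have [_ /eqP] := nu erefl.
    by rewrite (eq_sym v) eqxx uv => -> /=; rewrite orbT.
  + by rewrite ev in uv nv; have [_ /eqP ->] := nv erefl; rewrite eqxx uv /= !orbT.
  + by rewrite uv neq_adj.
Qed.

Lemma arcs_gt0_adj (G : sgraph) : 0 < #|arcs G| -> exists x y : G, adj x y.
Proof. by case/card_gt0P=> -[x y]; rewrite inE => xy; exists x, y. Qed.

(* Mader: in a minimal minor of average degree at least 2k every edge lies in
   k triangles, so the neighbourhood of a vertex of degree at most 2k is dense. *)
Lemma dense_minor k (G : sgraph) :
  0 < k -> 0 < #|G| -> 2 * k * #|G| <= #|arcs G| ->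
  exists H : sgraph, [/\ has_model H G, 0 < #|H| <= 2 * k
    & forall u : H, k <= #|nbrs u|].
Proof.
move=> k_gt0; have [n] := ubnP #|G|; elim: n G => // n IHn G.
have [m] := ubnP #|arcs G|; elim: m G => // m IHm G ltm ltn G_gt0 dG.
have IH (G' : sgraph) : has_model G' G -> 0 < #|G'| < #|G| -> 2 * k * #|G'| <= #|arcs G'| ->
    exists H : sgraph, [/\ has_model H G, 0 < #|H| <= 2 * k & forall u : H, k <= #|nbrs u|].
  move=> mG' /andP[G'_gt0 ltG'] dG'.
  have [|H [mH cH dH]] := IHn G' _ G'_gt0 dG'; first exact: leq_trans ltG' _.
  by exists H; split=> //; apply: has_model_trans mG'.
have /arcs_gt0_adj[x [y xy]] : 0 < #|arcs G| by apply: leq_trans dG; rewrite !muln_gt0 k_gt0.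
have nxy : x != y by apply: contraTneq xy => ->; rewrite adj_irrefl.
have G_gt1 : 1 < #|G|.
  by rewrite -[X in X < _](cards1 x); apply/proper_card/properP; split;
    [apply/subsetP | exists y; rewrite // inE eq_sym].
have [/existsP[v dv] | /existsPn allbig] :=
  boolP [exists v : G, #|nbrs v| <= 2 * k]; last first.
  (* All degrees exceed [2 * k], so the degree sum has a surplus of [#|G| >= 2], which pays for
     deleting one edge. The vertex count stays, hence the inner induction on arcs. *)
  pose G' := subgraph [set: G] (~: [set [set x; y]]).
  have cG' : #|G'| = #|G| by rewrite card_sig; apply: eq_card => v; rewrite !inE.
  have ltG' : #|arcs G'| < #|arcs G|.
    rewrite [X in _ < X](cardsD1 (x, y)) inE xy ltnS.
    apply: (@leq_card_in_imset _ _ _ _ (fun a => (val a.1, val a.2))).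
      by move=> [a b] [a' b'] _ _ [/val_inj -> /val_inj ->].
    move=> [a b]; rewrite inE => /andP[/= ab nF]; rewrite !inE /= ab andbT.
    by apply: contraTneq nF => -[-> ->]; rewrite !inE eqxx.
  have leG' : #|arcs G| <= #|arcs G'| + 2.
    pose inG' u : G' := insubd (Sub x (in_setT x)) u.
    have inG'K u : val (inG' u) = u by rewrite insubdK // inE.
    apply: (@leq_trans (#|arcs G :\: [set (x, y); (y, x)]| + 2)).
      rewrite -(cardsID [set (x, y); (y, x)] (arcs G)) addnC leq_add2l.
      by apply: leq_trans (subset_leq_card (subsetIr _ _)) _; rewrite cards2; case: eqP.
    rewrite leq_add2r; apply: (@leq_card_in_imset _ _ _ _ (fun a => (inG' a.1, inG' a.2))).
      move=> [a b] [a' b'] _ _ [/(congr1 val) + /(congr1 val)].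
      by rewrite !inG'K => -> ->.
    move=> [a b]; rewrite !inE /= => /andP[nab ab]; rewrite /subgraph_adj !inG'K ab /= !inE.
    apply: contraNneq nab => eq.
    have : a \in [set x; y] by rewrite -eq !inE eqxx.
    have : b \in [set x; y] by rewrite -eq !inE eqxx orbT.
    have : a != b by apply: contraTneq ab => ->; rewrite adj_irrefl.
    rewrite !inE => nab /orP[/eqP eb|/eqP eb] /orP[/eqP ea|/eqP ea]; move: nab;
      by rewrite ea eb ?eqxx ?orbT.
  have [||||H [mH cH dH]] := IHm G'.
  - exact: leq_trans ltG' _.
  - by rewrite cG'.
  - by rewrite cG'.
  - suff : #|G| + #|G| * (2 * k) <= #|arcs G|.
      by move: leG' G_gt1; rewrite cG'; card_nia.
    rewrite -mulnS card_arcs -sum_nat_const; apply: leq_sum => u _.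
    by have := allbig u; rewrite -ltnNge.
  by exists H; split=> //; apply: has_model_trans mH (has_model_subgraph _ _).
have [dv0 | dv_gt0] := posnP #|nbrs v|.
  (* Deleting an isolated vertex loses no arc. *)
  pose G' := induced [set~ v].
  have cG' : #|G'| = #|G|.-1.
    by rewrite card_sig -(cardC1 v); apply: eq_card => u; rewrite !inE.
  apply: (IH G'); first exact: has_model_subgraph.
    by rewrite cG'; move: G_gt1; card_nia.
  have xv : x \in [set~ v].
    rewrite !inE; apply: contraTneq xy => eqx; apply/negP => xy.
    by have : y \in nbrs v; [rewrite inE -eqx | rewrite (cards0_eq dv0) inE].
  pose inG' u : G' := insubd (Sub x xv) u.
  have inG'K u w : adj u w -> val (inG' u) = u.
    move=> uw; rewrite insubdK // !inE; apply: contraTneq uw => equ; apply/negP => uw.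
    by have : w \in nbrs v; [rewrite inE -equ | rewrite (cards0_eq dv0) inE].
  apply: leq_trans (_ : #|arcs G| <= _).
    by apply: leq_trans dG; rewrite cG' leq_mul2l leq_pred orbT.
  apply: (@leq_card_in_imset _ _ _ _ (fun a => (inG' a.1, inG' a.2))).
    move=> [a b] [a' b']; rewrite !inE /= => ab ab' [/(congr1 val) + /(congr1 val)].
    rewrite (inG'K _ _ ab) (inG'K _ _ ab'); move: ab ab'; rewrite adj_sym (adj_sym a').
    by move=> /inG'K-> /inG'K-> -> ->.
  move=> [a b]; rewrite !inE /= => ab; rewrite /subgraph_adj inE andbT (inG'K _ _ ab).
  by move: (ab); rewrite adj_sym => /inG'K->.
have [/existsP[w /andP[vw lew]] | /existsPn tri] :=
  boolP [exists w, adj v w && (#|nbrs v :&: nbrs w| < k)].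
  (* Contracting [vw] loses one vertex and at most [2 * k] arcs, so the density survives. *)
  have nvw : v != w by apply: contraTneq vw => ->; rewrite adj_irrefl.
  have cG' : #|contract v w| = #|G|.-1 by rewrite card_sig -(cardC1 w); apply: eq_card.
  apply: (IH (contract v w)); first exact: has_model_contract.
    by rewrite cG'; move: G_gt1; card_nia.
  have := card_arcs_contract vw; rewrite cG'; move: dG lew G_gt1; card_nia.
exists (induced (nbrs v)); split; first exact: has_model_subgraph.
  by rewrite card_sig dv andbT.
move=> u; have uv := valP u; rewrite inE in uv.
have := tri (val u); rewrite uv /= -leqNgt => /leq_trans; apply.
apply: (@leq_card_in_imset _ _ _ _ (insubd u)).
  move=> a b; rewrite !inE => /andP[va _] /andP[vb _] /(congr1 val).
  by rewrite !insubdK ?inE.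
move=> a; rewrite !inE => /andP[va ua]; rewrite /= /subgraph_adj insubdK ?inE //.
by rewrite ua.
Qed.

(** * Contracting balls in graphs of large girth *)

Definition walk (T : finType) (e : rel T) n u v : Prop :=
  exists p, [/\ path e u p, last u p = v & size p <= n].

Section Walks.
Variables (T : finType) (e : rel T).

Lemma walk0 u n : walk e n u u.
Proof. by exists [::]. Qed.

Lemma walk1 u v : e u v -> walk e 1 u v.
Proof. by exists [:: v]; rewrite /= andbT. Qed.

Lemma walk_trans m n u v w : walk e m u v -> walk e n v w -> walk e (m + n) u w.
Proof.
move=> [p [pp <- sp]] [q [qq <- sq]]; exists (p ++ q).
by rewrite cat_path pp qq last_cat size_cat leq_add.
Qed.

Lemma walk_sym n u v : symmetric e -> walk e n u v -> walk e n v u.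
Proof.
move=> syme [p [pp <- sp]]; exists (rev (belast u p)).
rewrite size_rev size_belast; split=> //; first by rewrite rev_path (@eq_path _ _ e).
by case: p {pp sp} => //= a p; rewrite rev_cons last_rcons.
Qed.

Lemma walk_leq m n u v : m <= n -> walk e m u v -> walk e n u v.
Proof. by move=> le [p [? ? sp]]; exists p; split=> //; apply: leq_trans le. Qed.

End Walks.

Definition adj_avoid (G : sgraph) (u v : G) : rel G :=
  fun a b => [&& adj a b, (a, b) != (u, v) & (a, b) != (v, u)].

Lemma adj_avoid_sym (G : sgraph) (u v : G) : symmetric (adj_avoid u v).
Proof.
move=> a b; rewrite /adj_avoid adj_sym; congr (_ && _); rewrite andbC.
by rewrite -!pair_eqE /= ![(a == _) && _]andbC.
Qed.

(** The walk shortens to a path, which has at least two edges because it avoids [uv]; adding [uv]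
    closes a cycle. *)
Lemma cycle_of_detour (G : sgraph) (u v : G) n :
  adj u v -> walk (adj_avoid u v) n u v ->
  exists2 q : seq G, graph_cycle q & size q <= n.+1.
Proof.
move=> uv [p [pp]]; have nuv : u != v by apply: contraTneq uv => ->; rewrite adj_irrefl.
case/shortenP: pp => p' pp' uniqp' subp' lastp' sp.
exists (u :: p') => /=.
  split.
    case: p' pp' lastp' {uniqp' subp'} => [_ /= eq|z [|//] /= /andP[+ _] eq].
      by rewrite eq eqxx in nuv.
    by rewrite eq /adj_avoid eqxx /= andbF.
  rewrite /ucycle uniqp' andbT /= rcons_path lastp' adj_sym uv andbT.
  by apply: sub_path pp' => a b /and3P[].
by rewrite ltnS (leq_trans _ sp) // uniq_leq_size //; case/andP: uniqp'.
Qed.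

(** * Balls, packings and breadth-first forests *)

Section Ball.
Variable G : sgraph.
Implicit Types (A X : {set G}) (u v w x : G).

Definition ball n A : {set G} := iter n (cnbhd setT) A.

Lemma ballP n A v : reflect (exists2 x, x \in A & walk (@adj G) n x v) (v \in ball n A).
Proof.
apply: (iffP idP) => [|[x xA [p [pp <- sp]]]].
  elim: n v => [|n IH] v /=; first by exists v => //; exact: walk0.
  case/cnbhdP=> _ [u /IH[x xA xu] [<-|uv]]; exists x => //.
    exact: walk_leq xu.
  by rewrite -addn1; apply: walk_trans xu (walk1 uv).
elim: n p pp sp => [|n IH] p; first by case: p.
case/lastP: p => [_ _ | p w].
  by apply: (subsetP (cnbhd_ext (subsetT _))); apply: (IH [::]).
rewrite rcons_path last_rcons size_rcons ltnS => /andP[pp pw] sp.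
by apply/cnbhdP; rewrite inE; split=> //; exists (last x p); [apply: IH | right].
Qed.

(** A vertex outside the balls around a largest packing could be added to it. *)
Lemma maximal_packing n : exists X : {set G},
  (forall x y, x \in X -> y \in X -> walk (@adj G) n x y -> x = y) /\
  ball n X = setT.
Proof.
pose P X := [forall x in X, forall y in X, (y \in ball n [set x]) ==> (x == y)].
have P0 : P set0 by apply/forall_inP=> x; rewrite inE.
case: (arg_maxnP (fun X => #|X|) P0) => X PX maxX.
have packX x y : x \in X -> y \in X -> walk (@adj G) n x y -> x = y.
  move=> xX yX xy; apply/eqP; move/forall_inP: PX => /(_ x xX)/forall_inP/(_ y yX)/implyP.
  by apply; apply/ballP; exists x; rewrite ?inE.
exists X; split=> //; apply/setP=> v; rewrite inE; apply/negPn/negP=> vX.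
have far x : x \in X -> ~ walk (@adj G) n x v.
  by move=> xX xv; case/negP: vX; apply/ballP; exists x.
have vnX : v \notin X by apply/negP=> /far; apply; exact: walk0.
suff /maxX : P (v |: X) by rewrite cardsU1 vnX /= add1n ltnn.
apply/forall_inP=> x xX; apply/forall_inP=> y yX; apply/implyP=> /ballP[_ /set1P-> xy].
move: xX yX xy; rewrite !inE => /orP[/eqP->|xX] /orP[/eqP->|yX] xy //.
- by case: (far y yX); apply: walk_sym xy; apply: adj_sym.
- by case: (far x xX).
- by rewrite (packX x y).
Qed.

End Ball.

Section Quotient.
Variables (G : sgraph) (X : {set G}) (c : G -> G).

Definition quotient_adj : rel {x : G | x \in X} := fun x y =>
  (x != y) && [exists u, exists v, [&& c u == val x, c v == val y & adj u v]].

Lemma quotient_sym : symmetric quotient_adj.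
Proof.
move=> x y; rewrite /quotient_adj eq_sym; congr (_ && _).
by apply/existsP/existsP => -[u /existsP[v /and3P[cu cv uv]]]; exists v; apply/existsP;
  exists u; rewrite cu cv adj_sym.
Qed.

Lemma quotient_irrefl : irreflexive quotient_adj.
Proof. by move=> x; rewrite /quotient_adj eqxx. Qed.

Definition quotient_graph : sgraph := SGraph quotient_sym quotient_irrefl.

End Quotient.

(* X is the set of roots, d the depth and p the parent function, with p v = v on
   the roots. *)
Record bfs_forest (G : sgraph) r (X : {set G}) (d : G -> nat) (p : G -> G) : Prop := {
  bfs_root : forall v, v \in X -> d v = 0 /\ p v = v;
  bfs_parent : forall v, v \notin X -> adj v (p v) /\ (d (p v)).+1 = d v;
  bfs_depth : forall v, d v <= 2 * r;
  bfs_lipschitz : forall u v, adj u v -> d v <= (d u).+1;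
  bfs_packing : forall x y, x \in X -> y \in X -> walk (@adj G) (2 * r) x y -> x = y }.

(** [X] is a maximal packing at distance [2 * r], [d] the distance to [X], and [p] picks a neighbour
    one step closer. *)
Lemma bfs_forest_exists (G : sgraph) r : exists X d p, @bfs_forest G r X d p.
Proof.
have [X [packX coverX]] := maximal_packing G (2 * r).
have /fin_all_exists[d dP] v : exists d, v \in ball d X /\ forall n, v \in ball n X -> d <= n.
  have ex : exists n, v \in ball n X by exists (2 * r); rewrite coverX inE.
  by exists (ex_minn ex); case: ex_minnP.
have dball v : v \in ball (d v) X by have [] := dP v.
have dmin v n : v \in ball n X -> d v <= n by have [_] := dP v; apply.
have dX v : v \in X -> d v = 0 by move=> vX; apply/eqP; rewrite -leqn0; apply: dmin.
have lip u v : adj u v -> d v <= (d u).+1.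
  by move=> uv; apply: dmin; apply/cnbhdP; rewrite inE; split=> //; exists u; [|right].
have /fin_all_exists[p pP] v : exists w, (v \in X -> w = v) /\
    (v \notin X -> adj v w /\ (d w).+1 = d v).
  have [vX|vX] := boolP (v \in X); first by exists v.
  have := dball v; case E: (d v) => [|n]; first by rewrite /= (negPf vX).
  case/cnbhdP=> _ [u un [eq|uv]].
    by rewrite eq in un; have := dmin _ _ un; rewrite E ltnn.
  exists u; split=> // _; split; first by rewrite adj_sym.
  by apply/eqP; rewrite eqn_leq ltnS dmin // -E lip.
exists X, d, p; split=> //.
- by move=> v vX; split; [apply: dX | have [->] := pP v].
- by move=> v vX; have [_] := pP v; apply.
- by move=> v; apply: dmin; rewrite coverX inE.
Qed.

(** * Cells of the forest and their quotient *)

Section LargeGirth.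
Variables (G : sgraph) (r : nat) (X : {set G}) (d : G -> nat) (p : G -> G).
Hypothesis forest : bfs_forest r X d p.
Hypothesis girthG : forall q : seq G, graph_cycle q -> 8 * r + 2 < size q.

(** Depths are at most [2 * r] and [p] fixes the roots, so this many iterations reach the root and
    stay there. *)
Definition bfs_center v := iter (2 * r) p v.
Local Notation c := bfs_center.

Lemma bfs_depth0 v : (d v == 0) = (v \in X).
Proof.
have [vX|/(bfs_parent forest)[_ <-]//] := boolP (v \in X).
by have [-> _] := bfs_root forest vX.
Qed.

Lemma bfs_center_in v : c v \in X.
Proof.
have dp n u : d u <= n -> d (iter n p u) = 0.
  elim: n u => [|n IH] u; first by rewrite leqn0 => /eqP.
  rewrite iterSr => le; apply: IH; have [uX|/(bfs_parent forest)[_ E]] := boolP (u \in X).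
    by have [du ->] := bfs_root forest uX; rewrite du.
  by rewrite -ltnS E.
by rewrite -bfs_depth0 dp // (bfs_depth forest).
Qed.

Lemma bfs_center_parent v : c (p v) = c v.
Proof.
rewrite /c -iterSr /=; apply: (bfs_root forest _).2; exact: bfs_center_in.
Qed.

Lemma bfs_center_root v : v \in X -> c v = v.
Proof.
move=> /(bfs_root forest)[_ pv]; rewrite /c.
by elim: (2 * r) => //= n ->.
Qed.

Definition tree_arc (a : G * G) := (p a.1 == a.2) || (p a.2 == a.1).

(** The relation is left general to serve both [adj] and [adj_avoid u v] for a non-tree edge
    [uv]. *)
Lemma walk_to_center (e : rel G) v :
  (forall w, w \notin X -> e w (p w)) -> walk e (d v) v (c v).
Proof.
move=> ep; move E: (d v) => n; elim: n v E => [|n IH] v E.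
  have vX : v \in X by rewrite -bfs_depth0 E.
  by rewrite bfs_center_root //; exact: walk0.
have vX : v \notin X by rewrite -bfs_depth0 E.
have [_ dp] := bfs_parent forest vX; rewrite -bfs_center_parent.
have := IH (p v); rewrite E in dp; case: dp => dp /(_ dp) w.
by have := walk_trans (walk1 (ep v vX)) w; rewrite add1n.
Qed.

Lemma adj_avoid_parent u v w :
  ~~ tree_arc (u, v) -> w \notin X -> adj_avoid u v w (p w).
Proof.
rewrite /tree_arc negb_or /= => /andP[nu nv] /(bfs_parent forest)[wp _].
rewrite /adj_avoid wp /=; apply/andP; split.
  by apply: contraNneq nu => -[-> ->].
by apply: contraNneq nv => -[-> ->].
Qed.

(* An edge uv outside the forest with both ends in one cell closes a cycle of
   length at most 4r + 1 through the centre. *)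
Lemma center_neq u v : adj u v -> ~~ tree_arc (u, v) -> c u != c v.
Proof.
move=> uv ntr; apply/eqP=> ceq; have ep w := @adj_avoid_parent u v w ntr.
have wu := walk_to_center u ep; have wv := walk_sym (adj_avoid_sym u v) (walk_to_center v ep).
rewrite -ceq in wv; have [q cq] := cycle_of_detour uv (walk_trans wu wv).
have := girthG cq; have := bfs_depth forest u; have := bfs_depth forest v.
by clear; lia.
Qed.

(* Two edges joining the same two cells close a cycle of length at most 8r + 2
   through both centres. *)
Lemma center_inj u v u' v' :
  adj u v -> ~~ tree_arc (u, v) -> adj u' v' -> ~~ tree_arc (u', v') ->
  c u = c u' -> c v = c v' -> (u, v) = (u', v').
Proof.
move=> uv ntr uv' ntr' cu cv; apply/eqP/negPn/negP=> neq.
have ep w := @adj_avoid_parent u v w ntr.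
have wc z := walk_to_center z ep.
have wc' z := walk_sym (adj_avoid_sym u v) (walk_to_center z ep).
(* The reversed pair [(v, u)] is excluded too: it would give [c u = c v]. *)
have : adj_avoid u v u' v'.
  rewrite /adj_avoid uv' eq_sym neq /=; apply: contraNneq (center_neq uv ntr) => -[eu' _].
  by rewrite cu eu'.
move=> /walk1 w1; have w2 := wc' u'; rewrite -cu in w2; have w3 := wc v'; rewrite -cv in w3.
have [q cq] := cycle_of_detour uv
  (walk_trans (wc u) (walk_trans w2 (walk_trans w1 (walk_trans w3 (wc' v))))).
have := girthG cq; have := bfs_depth forest u; have := bfs_depth forest v.
have := bfs_depth forest u'; have := bfs_depth forest v'.
by clear; lia.
Qed.

Local Notation H := (quotient_graph X c).

(** The branch sets are the cells, connected because parent paths never leave them. *)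
Lemma has_model_quotient : has_model H G.
Proof.
exists (fun x : H => [set v | c v == val x]); split.
- by move=> x; apply/set0Pn; exists (val x); rewrite inE bfs_center_root //; apply: valP.
- move=> x; set A := [set _ | _]; apply: (@connected_set_root _ _ (val x)) => v.
  move E: (d v) => n; elim: n v E => [|n IH] v E vA; have cv := vA; rewrite inE in cv.
    have vX : v \in X by rewrite -bfs_depth0 E.
    by rewrite -(eqP cv) bfs_center_root.
  have vX : v \notin X by rewrite -bfs_depth0 E.
  have [vp dp] := bfs_parent forest vX; rewrite E in dp; case: dp => dp.
  have pA : p v \in A by rewrite inE bfs_center_parent.
  by apply: connect_trans (IH _ dp pA); apply: connect1; rewrite /adj_in vA pA.
- move=> x y neq; rewrite -setI_eq0; apply/eqP/setP=> v; rewrite !inE.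
  by apply/negP=> /andP[/eqP-> /eqP/val_inj eq]; rewrite eq eqxx in neq.
- move=> x y /andP[_ /existsP[u /existsP[v /and3P[cu cv uv]]]].
  by exists u, v; rewrite !inE.
Qed.

(** Non-tree arcs inject into the arcs of the quotient, and each non-root accounts for at most two
    tree arcs. *)
Lemma card_arcs_quotient : #|arcs G| <= #|arcs H| + 2 * (#|G| - #|X|).
Proof.
pose T : {set G * G} := [set (v, p v) | v in ~: X] :|: [set (p v, v) | v in ~: X].
have cT : #|T| <= 2 * (#|G| - #|X|).
  apply: leq_trans (leq_card_setU _ _) _.
  have <- : #|~: X| = #|G| - #|X| by rewrite cardsCs setCK.
  by rewrite mul2n -addnn leq_add // leq_imset_card.
apply: leq_trans (leq_add (leqnn _) cT); rewrite -(cardsID T) addnC.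
apply: leq_add; last by rewrite subset_leq_card ?subsetIr.
have arcP u v : (u, v) \in arcs G :\: T -> adj u v /\ ~~ tree_arc (u, v).
  case/setDP=> /[!inE]/= uv nT; split=> //; apply: contra nT.
  have inX w : adj w (p w) -> w \in ~: X.
    rewrite inE; apply: contraTN => /(bfs_root forest)[_ ->]; by rewrite adj_irrefl.
  case/orP=> /eqP/= eq; subst.
    by rewrite imset_f ?inX.
  apply/orP; right; apply/imsetP; exists v; rewrite // inX //.
  by rewrite adj_sym.
pose cc v : H := Sub (c v) (bfs_center_in v).
apply: (@leq_card_in_imset _ _ _ _ (fun a => (cc a.1, cc a.2))).
  move=> [u v] [u' v'] /arcP[uv ntr] /arcP[uv' ntr'] /= [cu cv].
  by have := center_inj uv ntr uv' ntr' cu cv.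
move=> [u v] /arcP[uv ntr]; rewrite inE /=; apply/andP; split.
  by rewrite -val_eqE /= center_neq.
by apply/existsP; exists u; apply/existsP; exists v; rewrite /= !eqxx.
Qed.

(** * Growth of the breadth-first levels *)

Hypothesis deg2 : forall v : G, 2 <= #|nbrs v|.
Hypothesis deg3 : forall u v : G, adj u v -> #|nbrs u| <= 2 -> 3 <= #|nbrs v|.

(** At a root [p v = v] is no neighbour and nothing is removed. Only below depth [r] are these shown
    to be forest children. *)
Definition children v : {set G} := nbrs v :\ p v.

Lemma card_children v : #|nbrs v| <= #|children v|.+1.
Proof. by rewrite (cardsD1 (p v)); case: (_ \in _). Qed.

(** Were [vw] not a tree edge, [center_neq] would give two distinct centres, joined through [v] and
    [w] by a walk of length at most [2 * d v + 2 <= 2 * r], against the packing. *)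
Lemma childrenP v w : d v < r -> w \in children v ->
  [/\ adj v w, p w = v & d w = (d v).+1].
Proof.
move=> ltvr; rewrite !inE => /andP[wpv vw].
have pw : p w = v.
  apply/eqP/negPn/negP=> npw; have ntr : ~~ tree_arc (v, w).
    by rewrite /tree_arc /= negb_or npw eq_sym wpv.
  have := center_neq vw ntr; rewrite (_ : c v = c w) ?eqxx //.
  have ep u : u \notin X -> adj u (p u) by case/(bfs_parent forest).
  have wv := walk_sym (@adj_sym G) (walk_to_center v ep).
  apply: (bfs_packing forest); rewrite ?bfs_center_in //.
  apply: walk_leq (walk_trans wv (walk_trans (walk1 vw) (walk_to_center w ep))).
  by have := bfs_lipschitz forest vw; clear - ltvr; lia.
split=> //; have wX : w \notin X.
  by apply/negP=> /(bfs_root forest)[_]; rewrite pw => eq; rewrite eq adj_irrefl in vw.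
by have [_ <-] := bfs_parent forest wX; rewrite pw.
Qed.

Lemma child_exists v : exists w, w \in children v.
Proof. by apply/card_gt0P; have := deg2 v; have := card_children v; clear; lia. Qed.

(** Either two children have a child each, or the only child has a neighbour [v] of degree 2, hence
    degree at least 3 and two children. *)
Lemma grandchildren v : (d v).+1 < r ->
  exists w1 w2, [/\ w1 != w2, p (p w1) = v, p (p w2) = v,
    d w1 = (d v).+2 & d w2 = (d v).+2].
Proof.
move=> ltvr; have chv w := @childrenP v w (ltnW ltvr).
have chw w z : w \in children v -> z \in children w -> p z = w /\ d z = (d v).+2.
  by move=> /chv[_ _ dw] /childrenP[|_ -> ->]; rewrite dw.
have [/card_gt1P[w1 [w2 [w1v w2v neq]]] | le1] := ltnP 1 #|children v|.
  have [z1 z1w] := child_exists w1; have [z2 z2w] := child_exists w2.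
  have [p1 d1] := chw _ _ w1v z1w; have [p2 d2] := chw _ _ w2v z2w.
  have [_ q1 _] := chv _ w1v; have [_ q2 _] := chv _ w2v.
  exists z1, z2; rewrite p1 p2; split=> //.
  by apply: contraNneq neq => eq; rewrite -p1 -p2 eq.
have [w wv] := child_exists v; have [vw q _] := chv _ wv.
have /card_gt1P[z1 [z2 [z1w z2w neq]]] : 1 < #|children w|.
  have := deg3 vw; have := card_children w; have := card_children v.
  by move: le1; card_nia.
have [p1 d1] := chw _ _ wv z1w; have [p2 d2] := chw _ _ wv z2w.
by exists z1, z2; rewrite p1 p2.
Qed.

Definition level j : {set G} := [set v | d v == j].

Lemma card_level2 j : j.+1 < r -> 2 * #|level j| <= #|level j.+2|.
Proof.
move=> ltjr.
have /fin_all_exists[f fP] v : exists w : bool -> G, v \in level j ->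
    w true != w false /\ forall b, p (p (w b)) = v /\ d (w b) = j.+2.
  have [/[!inE]/eqP dv|_] := boolP (v \in level j); last by exists (fun=> v).
  have [|w1 [w2 [neq p1 p2 d1 d2]]] := @grandchildren v; first by rewrite dv.
  by exists (fun b : bool => if b then w1 else w2) => _; split=> // -[]; rewrite -dv.
rewrite mulnC -card_bool -cardsT -cardsX.
apply: (@leq_card_in_imset _ _ _ _ (fun a => f a.1 a.2)).
  move=> [v b] [v' b'] /setXP[/= vj _] /setXP[/= vj' _] eq.
  have [neq /(_ b)[pv _]] := fP v vj; have [_ /(_ b')[pv' _]] := fP v' vj'.
  have eqv : v = v' by rewrite -pv -pv' eq.
  move: eq; rewrite -eqv; case: b {pv}; case: b' {pv'} => // eq.
    by rewrite eq eqxx in neq.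
  by rewrite -eq eqxx in neq.
by move=> [v b] /setXP[/= vj _]; have [_ /(_ b)[_ dw]] := fP v vj; rewrite inE dw.
Qed.

Lemma card_level i : 2 * i <= r -> 2 ^ i * #|X| <= #|level (2 * i)|.
Proof.
elim: i => [|i IH] le.
  by rewrite mul1n subset_leq_card //; apply/subsetP=> v; rewrite inE bfs_depth0.
have := IH; have := @card_level2 (2 * i); rewrite mulnS expnS.
by rewrite -mulnA => h1 h2; apply: leq_trans (h1 _); [rewrite leq_pmul2l ?h2 //; lia | lia].
Qed.

(** A vertex at level [2 * m] has degree at least 3 or has a child that does; depth tells the two
    cases apart, so the choice is injective. *)
Lemma card_branching m : r = (2 * m).+1 ->
  2 ^ m * #|X| <= #|[set v : G | 3 <= #|nbrs v|]|.
Proof.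
move=> def_r; apply: leq_trans (card_level _) _; first by rewrite def_r.
have /fin_all_exists[f fP] v : exists w, v \in level (2 * m) ->
    3 <= #|nbrs w| /\ (w = v \/ p w = v /\ d w = (2 * m).+1).
  have [big|small] := ltnP 2 #|nbrs v|; first by exists v => _; split; [|left].
  have [w wv] := child_exists v; exists w; rewrite inE => /eqP dv.
  have [|vw pw dw] := childrenP _ wv; first by rewrite def_r dv.
  by split; [apply: deg3 vw small | right; rewrite dw dv].
apply: (@leq_card_in_imset _ _ _ _ f) => [v v' vl vl' eq | v vl]; last first.
  by rewrite inE; have [] := fP v vl.
have [_ fv] := fP v vl; have [_ fv'] := fP v' vl'; rewrite !inE in vl vl'.
case: fv fv' => [fv|[pv dv]] [fv'|[pv' dv']].
- by rewrite -fv eq.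
- by rewrite -eq fv (eqP vl) in dv'; lia.
- by rewrite eq fv' (eqP vl') in dv; lia.
- by rewrite -pv eq.
Qed.

End LargeGirth.

(** The degree sum is at least [2 * #|G| + 2 ^ m * #|X|], and passing to the quotient loses at most
    [2 * (#|G| - #|X|)] arcs. The girth bound is [8 * r + 2] at [r = 2 * m + 1]. *)
Lemma large_girth_minor m (G : sgraph) :
  0 < #|G| -> (forall v : G, 2 <= #|nbrs v|) ->
  (forall u v : G, adj u v -> #|nbrs u| <= 2 -> 3 <= #|nbrs v|) ->
  (forall q : seq G, graph_cycle q -> 16 * m + 10 < size q) ->
  exists H : sgraph, [/\ has_model H G, 0 < #|H| & 2 ^ m * #|H| <= #|arcs H|].
Proof.
move=> G_gt0 deg2 deg3 girthG.
have [X [d [p forest]]] := bfs_forest_exists G (2 * m).+1.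
have girthG' (q : seq G) : graph_cycle q -> 8 * (2 * m).+1 + 2 < size q.
  by move/girthG; clear; lia.
set c := bfs_center (2 * m).+1 p; exists (quotient_graph X c).
have -> : #|quotient_graph X c| = #|X| by rewrite card_sig; apply: eq_card.
split; first exact: (has_model_quotient forest).
  have /card_gt0P[v _] := G_gt0; apply/card_gt0P; exists (c v).
  exact: (bfs_center_in forest).
have := card_arcs_quotient forest girthG'; rewrite -/c.
have := card_branching forest girthG' deg2 deg3 erefl.
have : 2 * #|G| + #|[set v : G | 3 <= #|nbrs v|]| <= #|arcs G|.
  rewrite card_arcs mulnC -sum_nat_const -sum1_card big_mkcond /= [X in _ + X]big_mkcond /=.
  rewrite -big_split /=; apply: leq_sum => v _; rewrite inE.
  by have := deg2 v; case: (ltnP 2 #|nbrs v|).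
have := max_card X; move: (2 ^ m * _); card_nia.
Qed.

Lemma dense_has_clique_model a t (G : sgraph) :
  t * (6 * a + 24) <= 2 ^ a -> 0 < #|G| <= 2 * 2 ^ a.+1 ->
  (forall u : G, 2 ^ a.+1 <= #|nbrs u|) -> has_model (complete t) G.
Proof.
move=> lea /andP[G_gt0 leG] degG; have /card_gt0P[w _] := G_gt0.
have wT : w \in [set: G] by rewrite inE.
pose W := [set v in [set: G] | connect (adj_in setT) w v].
(* With [i = 3 * (a + 2)] rounds, [s = 12 + 2 * i], and [2 * 27 < 4 ^ 3] beats
   [#|G| <= 2 ^ (a + 2)]. The degree [2 ^ a.+1] splits into [d = 2 ^ a] and at least [t * s]. *)
have [||||||D modD] := @dense_clique_model G (2 ^ a) (6 * a + 24) (3 * a.+2) t W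
  _ _ _ _ _ (connected_component wT).
- by rewrite expn_gt0.
- by rewrite (leq_trans leG) // expnS mulnA.
- rewrite !expnM (_ : 4 ^ 3 = 32 * 2) // expnMn [X in _ < X]mulnC.
  apply: leq_ltn_trans (_ : 2 ^ a.+2 * 27 ^ a.+2 < _).
    by rewrite leq_mul2r -expnS in leG *; rewrite leG orbT.
  by rewrite ltn_pmul2l ?expn_gt0 // ltn_exp2r.
- by clear; lia.
- by apply/set0Pn; exists w; rewrite !inE connect0.
- move=> u uW; apply: leq_trans (leq_trans _ (degG u)) _.
    by rewrite expnS mul2n -addnn leq_add2l.
  apply/subset_leq_card/subsetP=> v; rewrite !inE => uv; rewrite uv andbT.
  by move: uW; rewrite !inE => /connect_trans; apply; apply: connect1; rewrite /adj_in !inE.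
exact: clique_model_has_model modD.
Qed.

(** * Colouring *)

Section Colouring.
Variable G : sgraph.
Implicit Types (S : {set G}) (u v w : G) (f : G -> bool).

(* The case u = v says that u has at most one neighbour in S. *)
Definition reducible_pair S u v :=
  (#|nbrs_in (S :\: [set u; v]) u| <= 1) && (#|nbrs_in (S :\: [set u; v]) v| <= 1).

Definition same_colour S f v : {set G} := [set w in nbrs_in S v | f w == f v].

Lemma avoid_colour f (A : {set G}) : #|A| <= 1 -> exists b, forall w, w \in A -> f w != b.
Proof.
move=> /card_le1_eqP le1; have [-> | /set0Pn[w wA]] := eqVneq A set0.
  by exists true => w; rewrite inE.
by exists (~~ f w) => w' w'A; rewrite (le1 w w' wA w'A); case: (f w).
Qed.

(** Each of [u] and [v] avoids the colour of its at most one neighbour in the rest. Old vertices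
    thus gain no neighbour of their colour, and [u], [v] can only clash with each other. *)
Lemma colour_reducible :
  (forall S, S != set0 -> exists u v, [/\ u \in S, v \in S & reducible_pair S u v]) ->
  forall S, exists f, forall v, v \in S -> #|same_colour S f v| <= 1.
Proof.
move=> red S; have [n] := ubnP #|S|; elim: n S => // n IH S ltS.
have [-> | nS] := eqVneq S set0; first by exists xpredT => v; rewrite inE.
have [u [v [uS vS /andP[ru rv]]]] := red S nS.
set S' := S :\: _ in ru rv.
have [|f fP] := IH S'.
  rewrite -ltnS; apply: leq_trans ltS; rewrite ltnS; apply: proper_card.
  by apply/properP; split; [apply: subsetDl | exists u; rewrite // !inE eqxx].
have [bu buP] := avoid_colour f ru; have [bv bvP] := avoid_colour f rv.
pose g x := if x == u then bu else if x == v then bv else f x.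
have gS' x : x \in S' -> g x = f x.
  by rewrite !inE negb_or /g => /andP[/andP[/negPf-> /negPf->]].
have inS' x : x \in S -> [|| x == u, x == v | x \in S'].
  by rewrite !inE => ->; rewrite andbT; do 2!case: (x == _).
have colu x : x \in S' -> adj u x -> g x != g u.
  by move=> xS' ux; rewrite gS' // /g eqxx buP // inE xS'.
have colv x : x \in S' -> adj v x -> g x != g v.
  move=> xS' vx; have [eq|neq] := eqVneq v u; first by rewrite eq colu // -eq.
  by rewrite gS' // /g (negPf neq) eqxx bvP // inE xS'.
exists g => x xS; have [xS' | xS'] := boolP (x \in S').
  apply: leq_trans (fP x xS'); apply/subset_leq_card/subsetP=> w.
  rewrite !inE -!andbA => /and3P[wS xw gwx]; rewrite xw /=.
  have /or3P[/eqP wu|/eqP wv|wS'] := inS' w wS.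
  - by have := colu x xS'; rewrite -wu adj_sym xw => /(_ isT); rewrite eq_sym gwx.
  - by have := colv x xS'; rewrite -wv adj_sym xw => /(_ isT); rewrite eq_sym gwx.
  by move: (wS'); rewrite !inE => /andP[-> ->] /=; rewrite -(gS' w wS') -(gS' x xS').
have xuv : (x == u) || (x == v) by have := inS' x xS; rewrite (negPf xS') orbF.
pose y := if x == u then v else u.
rewrite -(cards1 y); apply/subset_leq_card/subsetP=> w.
rewrite !inE -!andbA => /and3P[wS xw gwx].
have nwx : w != x by apply: contraTneq xw => ->; rewrite adj_irrefl.
have nwS' : w \notin S'.
  apply/negP=> wS'; case/orP: xuv => /eqP ex.
    by have := colu w wS'; rewrite -ex gwx xw => /(_ isT).
  by have := colv w wS'; rewrite -ex gwx xw => /(_ isT).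
have := inS' w wS; rewrite (negPf nwS') orbF /y.
have [exu|nxu] := eqVneq x u; first by rewrite -exu (negPf nwx).
by rewrite (negPf nxu) /= in xuv; rewrite -(eqP xuv) (negPf nwx) orbF.
Qed.

(** In a colour class all degrees are at most 1, so no path leaves the closed neighbourhood of [v],
    which has at most two vertices. *)
Lemma colourable_of_defect f :
  (forall v, #|same_colour setT f v| <= 1) -> colourable_with_clustering G 2 2.
Proof.
move=> defect; exists (fun v => if f v then ord0 else ord_max) => i v.
set K := induced _ in v *.
have fK (x y : K) : f (val x) = f (val y).
  have /[!inE]/eqP cx := valP x; have /[!inE]/eqP cy := valP y.
  by have := etrans cx (esym cy); do 2!case: (f _).
have degK (x : K) : #|nbrs x| <= 1.
  apply: leq_trans (defect (val x)).
  apply: (@leq_card_in_imset _ _ _ _ val) => [? ? _ _ /val_inj //|y].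
  by rewrite !inE => /andP[/= -> _] /=; rewrite (fK y x).
apply: leq_trans (_ : #|v |: nbrs v| <= 2); last first.
  by rewrite cardsU1 (leq_trans (leq_add (leq_b1 _) (degK v))).
apply/subset_leq_card/subsetP=> w; rewrite inE => vw; apply/negPn/negP=> nw.
have [|a [b [aA bA ab]]] := connect_exit vw _ nw; first by rewrite !inE eqxx.
case/setU1P: aA => [eq|va]; first by rewrite !inE -eq ab orbT in bA.
have /card_le1_eqP/(_ v b) eq := degK a; rewrite eq ?inE ?eqxx // in bA.
by rewrite inE in va; rewrite adj_sym.
Qed.

End Colouring.

Lemma card_nbrs_induced (G : sgraph) (S : {set G}) (x : induced S) :
  #|nbrs x| = #|nbrs_in S (val x)|.
Proof.
rewrite -(card_imset _ val_inj); apply: eq_card => v; apply/imsetP/idP.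
  by case=> y /[!inE]/andP[/= xy _] ->; rewrite xy andbT; apply: (valP y).
rewrite inE => /andP[vS xv]; exists (Sub v vS); last by [].
by rewrite !inE /= /subgraph_adj /= xv inE.
Qed.

Lemma graph_cycle_induced (G : sgraph) (S : {set G}) (q : seq (induced S)) :
  graph_cycle q -> graph_cycle (map val q).
Proof.
case=> szq /andP[cq uq]; split; first by rewrite size_map.
rewrite /ucycle map_inj_uniq ?uq ?andbT; last exact: val_inj.
case: q cq {szq uq} => //= x q; rewrite -map_rcons => pq.
by rewrite path_map; apply: sub_path pq => a b /andP[].
Qed.

Lemma girth_minor_colourable t a (G : sgraph) :
  t * (6 * a + 24) <= 2 ^ a ->
  (forall q : seq G, graph_cycle q -> 16 * a + 42 < size q) ->
  ~ minor (complete t) G -> colourable_with_clustering G 2 2.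
Proof.
move=> lea girthG nminor.
suff red S : S != set0 -> exists u v : G, [/\ u \in S, v \in S & reducible_pair S u v].
  have [f fP] := colour_reducible red setT.
  by apply: (@colourable_of_defect _ f) => v; rewrite fP ?inE.
move=> nS; have [/existsP[u /existsP[v /and3P[uS vS uv]]] | /existsPn irr] :=
  boolP [exists u, exists v, [&& u \in S, v \in S & reducible_pair S u v]].
  by exists u, v.
case: nminor; apply: has_model_minor.
have irred u v : u \in S -> v \in S -> ~~ reducible_pair S u v.
  by move=> uS vS; have := irr u; rewrite negb_exists => /forallP/(_ v); rewrite uS vS.
(* Irreducibility is applied to the pair with both entries equal to [x]. *)
have deg2 (x : induced S) : 2 <= #|nbrs x|.
  rewrite card_nbrs_induced; have := irred _ _ (valP x) (valP x).
  rewrite /reducible_pair andbb -ltnNge => /leq_trans; apply.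
  by apply/subset_leq_card/subsetP=> v; rewrite !inE => /andP[/andP[_ ->]].
have deg3 (x y : induced S) : adj x y -> #|nbrs x| <= 2 -> 3 <= #|nbrs y|.
  have remove (z w : induced S) : adj z w ->
      #|nbrs z| = #|nbrs_in (S :\: [set val z; val w]) (val z)|.+1.
    case/andP=> /= zw _; rewrite card_nbrs_induced (cardsD1 (val w)) !inE (valP w) zw add1n.
    congr _.+1; apply: eq_card => v; rewrite !inE.
    have [->|] := eqVneq v (val z); first by rewrite adj_irrefl !andbF.
    by case: (v == val w) => //= _; rewrite andbF.
  move=> xy; have yx : adj y x by rewrite adj_sym.
  have degy := remove y x yx; rewrite (setUC [set val y]) in degy.
  rewrite (remove x y xy) degy !ltnS => lex.
  by have := irred _ _ (valP x) (valP y); rewrite /reducible_pair lex /= -ltnNge.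
(* [dense_minor] with [k = 2 ^ a.+1] needs average degree [2 * k = 2 ^ a.+2]. *)
have [| //| //|q cq|H [mH H_gt0 dH]] := @large_girth_minor a.+2 (induced S).
- by have /set0Pn[u uS] := nS; apply/card_gt0P; exists (Sub u uS).
- have -> : 16 * a.+2 + 10 = 16 * a + 42 by clear; lia.
  by have := girthG _ (graph_cycle_induced cq); rewrite size_map.
have [|||H' [mH' cH' dH']] := @dense_minor (2 ^ a.+1) H.
- by rewrite expn_gt0.
- by [].
- by rewrite -expnS.
apply: has_model_trans (dense_has_clique_model lea cH' dH') _.
apply: has_model_trans mH' _; apply: has_model_trans mH _.
exact: has_model_subgraph.
Qed.

(* The least order of 2^a that absorbs the factor 6 a + 24 in clique_exponentP is
   t log t, hence the summand log log t. *)
Definition clique_exponent t := trunc_log 2 t + trunc_log 2 (trunc_log 2 t).+1 + 9.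

Lemma clique_exponentP t :
  t * (6 * clique_exponent t + 24) <= 2 ^ clique_exponent t.
Proof.
rewrite /clique_exponent; set L := trunc_log 2 t; set l := trunc_log 2 L.+1.
have ltt : t <= 2 ^ L.+1 by apply/ltnW/trunc_log_ltn.
have ltL : L.+1 <= 2 ^ l.+1 by apply/ltnW/trunc_log_ltn.
have lel : l <= L.
  rewrite -(@leq_exp2l 2) //; apply: leq_trans (ltn_expl L _) => //.
  exact: trunc_logP.
(* As [l <= L], [6 * (L + l + 9) + 24 <= 12 * L + 78 <= 78 * L.+1]; then [2 * 78 * 2 <= 2 ^ 9]. *)
apply: leq_trans (_ : 2 ^ L.+1 * (78 * 2 ^ l.+1) <= _).
  by apply: leq_mul ltt _; move: ltL lel; move: (2 ^ l.+1); clear; lia.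
rewrite !expnS !expnD (_ : 2 ^ 9 = 512) //.
by move: (2 ^ L) (2 ^ l); clear; nia.
Qed.

Import Order.TTheory GRing.Theory Num.Theory.
Import numFieldNormedType.Exports.
Local Open Scope classical_set_scope.
Local Open Scope ring_scope.

(** * Asymptotics *)

Lemma log2_trunc_log (R : realType) t : (0 < t)%N ->
  (trunc_log 2 t)%:R <= log2 (t%:R : R) <= (trunc_log 2 t).+1%:R.
Proof.
move=> t_gt0; have ln2_gt0 : 0 < ln (2 : R) by rewrite ln_gt0 ?ltr1n.
have lnX n : ln ((2 ^ n)%:R : R) = n%:R * ln 2 by rewrite natrX lnXn // mulr_natl.
rewrite /log2 ler_pdivlMr // ler_pdivrMr // -!lnX.
rewrite !ler_ln ?posrE ?ltr0n ?expn_gt0 // !ler_nat.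
by rewrite trunc_logP // ltnW // trunc_log_ltn.
Qed.

(** With [2 ^ l <= L.+1] this gives [l.+1 ^ 2 <= 8 * L], so [l] is negligible against [L]. *)
Lemma sqr_le_expn2 l : (l.+1 ^ 2 <= 4 * 2 ^ l)%N.
Proof.
elim: l => // -[|[|l]] // IH; rewrite (expnS 2) mulnCA.
by apply: leq_trans (leq_mul (leqnn 2) IH); rewrite -!mulnn; clear; nia.
Qed.

Lemma clique_exponent_asymptotics (R : realType) :
  exists2 o1 : nat -> R, o1 @ \oo --> (0 : R) &
    \forall t \near \oo,
      (16 * clique_exponent t + 43)%:R = (16 + o1 t) * log2 (t%:R : R).
Proof.
pose o1 t : R := (16 * clique_exponent t + 43)%:R / log2 t%:R - 16.
have log2_ge t : (1 < t)%N -> 1 <= log2 (t%:R : R).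
  move=> t_gt1; have /andP[+ _] := log2_trunc_log R (ltnW t_gt1); apply: le_trans.
  by rewrite ler1n trunc_log_gt0.
exists o1; last first.
  exists 2%N => // t /= t_gt1; rewrite /o1 addrC subrK divfK //.
  by rewrite gt_eqF // (lt_le_trans ltr01) // log2_ge.
apply/cvgrPdist_le => e e_gt0.
(* [1624 = 8 * 203]: the numerator is at most [16 * l + 187 <= 203 * l.+1], and
   [l.+1 ^ 2 <= 8 * L]. *)
have [N leN] : exists N : nat, 1624 / e <= N%:R.
  exists (Num.bound (1624 / e)); apply/ltW/archi_boundP.
  by apply: divr_ge0; [exact: ler0n | exact: ltW].
(* This threshold forces [2 ^ N <= L], hence [N <= l]. *)
exists (2 ^ 2 ^ N)%N => // t /= leNt.
have t_gt1 : (1 < t)%N by apply: (leq_trans _ leNt); rewrite (@leq_exp2l 2 1) ?expn_gt0.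
have /andP[leL geL] := log2_trunc_log R (ltnW t_gt1); have x_ge1 := log2_ge t t_gt1.
rewrite sub0r normrN /o1 /clique_exponent.
set x := log2 _ in leL geL x_ge1 *; set L := trunc_log 2 t in leL geL *.
set l := trunc_log 2 L.+1.
have leNL : (2 ^ N <= L)%N by apply: trunc_log_max.
have leNl : (N <= l)%N by apply: trunc_log_max => //; apply: leqW.
have L_gt0 : (0 < L)%N by apply: leq_trans leNL; rewrite expn_gt0.
have lel : (l.+1 * l.+1 <= 8 * L)%N.
  have := sqr_le_expn2 l; have := trunc_logP (isT : (1 < 2)%N) (ltn0Sn L).
  by rewrite -/l -mulnn; lia.
have x_gt0 : 0 < x by apply: lt_le_trans x_ge1.
have -> : (16 * (L + l + 9) + 43)%:R / x - 16 = ((16 * (L + l + 9) + 43)%:R - 16 * x) / x.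
  by field; rewrite gt_eqF.
rewrite !(natrD, natrM) ger0_norm; last first.
  apply: divr_ge0; last exact: ltW.
  have := ler0n R l; rewrite -natr1 in geL; lra.
rewrite ler_pdivrMr //.
have leNe : 1624 <= e * l.+1%:R.
  rewrite mulrC -ler_pdivrMr // (le_trans leN) // ler_nat; exact: leqW.
have lel' : l.+1%:R * l.+1%:R <= 8 * (L%:R : R) by rewrite -!natrM ler_nat.
have l_ge1 : 1 <= (l.+1%:R : R) by rewrite ler1n.
apply: (@le_trans _ _ (203 * l.+1%:R)).
  by rewrite -natr1; have := ler0n R l; lra.
apply: (@le_trans _ _ (e * L%:R)); last by rewrite ler_pM2l.
have : 1624 * l.+1%:R <= e * (l.+1%:R * l.+1%:R).
  by rewrite mulrA ler_pM2r // (lt_le_trans ltr01).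
have : e * (l.+1%:R * l.+1%:R) <= e * (8 * L%:R) by rewrite ler_pM2l.
lra.
Qed.


Theorem theorem33 (R : realType) :
  exists g : nat -> R,
    (exists2 o1 : nat -> R, o1 @ \oo --> (0 : R) &
       \forall t \near \oo, g t = (16 + o1 t) * log2 (t%:R : R)) /\
    (forall (t : nat) (G : sgraph),
       ~ minor (complete t) G -> ((g t)%:E <= girth R G)%E ->
       colourable_with_clustering G 2 2).
Proof.
(* 43 is 42 plus one: [girth_minor_colourable] asks for cycles strictly longer than
   [16 * a + 42]. *)
exists (fun t => (16 * clique_exponent t + 43)%:R); split.
  exact: clique_exponent_asymptotics.
move=> t G nminor girthG.
apply: (girth_minor_colourable (clique_exponentP t)) nminor => q cq.
have : (((size q)%:R : R)%:E >= girth R G)%E by apply: ereal_inf_lbound; exists q.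
by move/(le_trans girthG); rewrite lee_fin ler_nat addnS.
Qed.
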